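(* Let $(E,d)$ be a metric space, let $0<\delta<1$ and $p\ge1$ (with $p<\infty$) be such that $\alpha=\delta-1/p>0$, and set $q=1/\delta$. Then there is a constant $C$ depending only on $\delta$ and $p$ such that for every continuous path $h:[0,1]\to E$ with $|h|_{W^{\delta,p};[0,1]}<\infty$, the map $$\omega(s,t)=|h|_{W^{\delta,p};[s,t]}^{q}\,(t-s)^{\alpha q},\qquad 0\le s\le t\le1,$$ is a control function and the $q$-variation of $h$ is controlled by $C\omega$, i.e. $|h|_{q\text{-var};[s,t]}^q\le C\,\omega(s,t)$ for all $0\le s\le t\le1$. In particular, $|h|_{\alpha\text{-H\''older}}\le C^{1/q}|h|_{W^{\delta,p};[0,1]}$ and $|h|_{q\text{-var};[0,1]}\le C^{1/q}|h|_{W^{\delta,p};[0,1]}$.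
   Context: For a continuous path $h:[0,1]\to E$ with values in a metric space $(E,d)$ and $0\le s\le t\le1$, set $$|h|_{W^{\delta,p};[s,t]}=\left(\int\!\!\int_{[s,t]^2}\frac{d(h_u,h_v)^p}{|v-u|^{1+\delta p}}\,du\,dv\right)^{1/p}\in[0,\infty],$$ $$|h|_{q\text{-var};[s,t]}=\sup\left(\sum_i d(h_{t_i},h_{t_{i+1}})^q\right)^{1/q},\qquad |h|_{\alpha\text{-H\''older}}=\sup_{0\le s<t\le1}\frac{d(h_s,h_t)}{|t-s|^{\alpha}},$$ where the supremum in the $q$-variation is over all finite partitions $(t_i)$ of $[s,t]$. A control function is a continuous map $(s,t)\mapsto\omega(s,t)\in[0,\infty)$, defined for $0\le s\le t\le1$, which is super-additive: $\omega(s,t)+\omega(t,u)\le\omega(s,u)$ for $s\le t\le u$. *)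

(* Defs.v *)
From mathcomp Require Import all_boot all_order all_algebra.
From mathcomp Require Import all_classical all_reals all_analysis.

Set Implicit Arguments.
Unset Strict Implicit.
Unset Printing Implicit Defensive.

Import Order.TTheory GRing.Theory Num.Theory.
Import numFieldNormedType.Exports.

Local Open Scope classical_set_scope.
Local Open Scope ring_scope.

(* A path [0, 1] -> E is a function h : R -> E of which only the values on
   [0, 1] matter: the definitions below only evaluate h on [s, t] (or [0, 1]). *)

(* Powers with real exponents: 0 `^ r = 0 for r != 0, and x / 0 = 0, so the
   integrand vanishes on the (Lebesgue-null) diagonal. *)
Definition sobolev_norm (R : realType) (E : metricType R) (delta p : R)
    (h : R -> E) (s t : R) : \bar R :=
  ((\int[(lebesgue_measure \x lebesgue_measure)%E]_(z in `[s, t] `*` `[s, t])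
     (mdist (h z.1) (h z.2) `^ p / `|z.2 - z.1| `^ (1 + delta * p))%:E)
   `^ p^-1)%E.

(* itv_partition s t l : s :: l is a strictly increasing list ending at t;
   for s = t the only one is l = [::], giving variation 0. *)
Definition q_variation (R : realType) (E : metricType R) (q : R)
    (h : R -> E) (s t : R) : \bar R :=
  ereal_sup [set ((\sum_(i < size l)
      mdist (h (nth t (s :: l) i)) (h (nth t (s :: l) i.+1)) `^ q) `^ q^-1)%:E
    | l in itv_partition s t].

Definition holder_norm (R : realType) (E : metricType R) (alpha : R)
    (h : R -> E) : \bar R :=
  ereal_sup [set (mdist (h z.1) (h z.2) / `|z.2 - z.1| `^ alpha)%:E
    | z in [set z : R * R | 0 <= z.1 /\ z.1 < z.2 /\ z.2 <= 1]].

Definition simplex01 (R : realType) : set (R * R) :=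
  [set z | 0 <= z.1 /\ z.1 <= z.2 /\ z.2 <= 1].

(* omega takes extended real values a priori; the first clause says that its
   values on the simplex lie in [0, +oo[, so that continuity for the topology
   of \bar R is continuity as a real-valued map. *)
Definition is_control (R : realType) (omega : R -> R -> \bar R) : Prop :=
  [/\ forall s t : R, 0 <= s -> s <= t -> t <= 1 -> (0 <= omega s t < +oo)%E,
      {within @simplex01 R, continuous (fun z : R * R => omega z.1 z.2)} &
      forall s t u : R, 0 <= s -> s <= t -> t <= u -> u <= 1 ->
        (omega s t + omega t u <= omega s u)%E].

(* Main.v *)
(* A metric-space form of the Garsia-Rodemich-Rumsey argument.  Let K be the
   kernel, A u its integral over v in [s, t], and F the double integral.  Along
   nested intervals J_n in [s, t], of length l_n = (t - s) / 2^n and shrinking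
   to an endpoint, a mean-value selection gives points x_n in J_n with
   A x_n <= 3 F / l_n and K (x_n, x_(n+1)) <= 9 F / (l_n l_(n+1)).  Hence
   d (h x_n, h x_(n+1)) <= (18 F)^(1/p) l_n^alpha, a geometric series because
   alpha > 0, and d (h s, h t) <= B F^(1/p) (t - s)^alpha by continuity of h.
   So d (h s, h t)^q is bounded by a multiple of
   omega = F^(q/p) (t - s)^(alpha q); since q/p + alpha q = 1 and F is
   superadditive, omega is superadditive by Hoelder's inequality, and summing
   over a partition bounds the q-variation. *)

Require Import Defs.
From mathcomp Require Import all_boot all_order all_algebra.
From mathcomp Require Import all_classical all_reals all_analysis.
From mathcomp Require Import measurable_realfun ring lra.

Import Order.TTheory GRing.Theory Num.Theory.
Import numFieldNormedType.Exports.

Local Open Scope classical_set_scope.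
Local Open Scope ring_scope.

Set Implicit Arguments.
Unset Strict Implicit.
Unset Printing Implicit Defensive.

Lemma open_measurable_prod (R : realType) (A : set (R * R)) :
  open A -> measurable A.
Proof.
move=> oA.
pose B (q : rat * rat * nat) : set (R * R) :=
  ball (ratr q.1.1 : R) q.2.+1%:R^-1 `*` ball (ratr q.1.2 : R) q.2.+1%:R^-1.
have -> : A = \bigcup_q (if `[< B q `<=` A >] then B q else set0).
  apply/seteqP; split => [[x y] Axy|z [q _]]; last first.
    by case: ifPn => // /asboolP; exact.
  have /nbhs_ballP[e /= e0 eA] := open_nbhs_nbhs (conj oA Axy).
  have [n ne] : exists n : nat, n.+1%:R^-1 < e / 2.
    have [n] := ltr_add_invr (divr_gt0 e0 (ltr0Sn R 1)).
    by rewrite add0r; exists n.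
  have n0 : 0 < (n.+1%:R^-1 : R) by rewrite invr_gt0.
  have appr (w : R) : exists q : rat, ball (ratr q : R) n.+1%:R^-1 w.
    have [|q /= ] := @rat_in_itvoo R (w - n.+1%:R^-1) w.
      by rewrite ltrBlDr ltrDl.
    rewrite in_itv/= => /andP[q1 q2]; exists q.
    by rewrite /ball/= ltr0_norm ?subr_lt0// opprB ltrBlDl -ltrBlDr.
  have [q1 q1x] := appr x; have [q2 q2y] := appr y.
  exists (q1, q2, n) => //.
  case: ifPn => [_|/asboolPn]; first by split.
  case=> -[u v] [/= uq vq]; apply: eA; split => /=.
    apply: (@le_ball _ _ _ (n.+1%:R^-1 + n.+1%:R^-1));
      first by rewrite [leRHS]splitr lerD// ltW.
    by apply: ball_triangle uq; exact: ball_sym.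
  apply: (@le_ball _ _ _ (n.+1%:R^-1 + n.+1%:R^-1));
      first by rewrite [leRHS]splitr lerD// ltW.
  by apply: ball_triangle vq; exact: ball_sym.
apply: countable_bigcupT_measurable => // q; case: ifPn => _ //.
by apply: measurableX; exact: measurable_ball.
Qed.

Lemma continuous_measurable_fun_prod (R : realType) (f : R * R -> R) :
  continuous f -> measurable_fun setT f.
Proof.
move=> /continuousP cf; apply: (measurability _ (RGenOpens.measurableE R)).
move=> _ [_ [a [b ->] <-]]; rewrite setTI; apply: open_measurable_prod.
exact/cf/interval_open.
Qed.

Lemma cvg_mdist (R : realType) (E : metricType R) (T : Type) (F : set_system T)
    (f g : T -> E) (x y : E) : Filter F ->
  f @ F --> x -> g @ F --> y -> mdist (f t) (g t) @[t --> F] --> mdist x y.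
Proof.
move=> FF fx gy; apply/cvgrPdist_lt => e e0.
have e2 : 0 < e / 2 by rewrite divr_gt0.
near=> t.
have : ball x (e / 2) (f t) by near: t; exact: fx _ (nbhsx_ballx x _ e2).
have : ball y (e / 2) (g t) by near: t; exact: gy _ (nbhsx_ballx y _ e2).
rewrite !ballEmdist/= => yg xf.
have := metric_triangle x (f t) y; have := metric_triangle (f t) (g t) y.
have := metric_triangle (f t) x (g t); have := metric_triangle x y (g t).
rewrite (metric_sym (f t) x) (metric_sym (g t) y) => *.
by rewrite ltr_norml; apply/andP; split; lra.
Unshelve. all: end_near. Qed.

Lemma measurable_mdist (R : realType) (E : metricType R) (h : R -> E) (a b : R) :
  a <= b -> {within `[a, b], continuous h} ->
  measurable_fun (`[a, b] `*` `[a, b]) (fun z : R * R => mdist (h z.1) (h z.2)).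
Proof.
move=> ab ch; pose cl (x : R) := Num.max a (Num.min x b).
have clab x : `[a, b]%classic (cl x).
  by rewrite /cl /= in_itv/= le_max lexx/= ge_max ab ge_min lexx orbT.
have cle (x : R) : `[a, b]%classic x -> cl x = x.
  by rewrite /= in_itv/= => /andP[ax xb]; rewrite /cl min_l ?max_r.
have ccl : continuous cl.
  apply: (@max_fun_continuous _ R R (cst a) (Num.min ^~ b)).
    by move=> x; exact: cvg_cst.
  by apply: (@min_fun_continuous _ R R id (cst b)) => x;
    [exact: cvg_id|exact: cvg_cst].
have chc : continuous (h \o cl).
  move=> x; move/subspace_continuousP : ch => /(_ _ (clab x)) hx.
  have clw : cl @ x --> within `[a, b]%classic (nbhs (cl x)).
    move=> A H.
    exact: (@filterS _ (nbhs x) _ (cl @^-1` [set y | `[a, b]%classic y -> A y])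
      (cl @^-1` A) (fun y Hy => Hy (clab y)) (ccl x _ H)).
  exact: cvg_comp clw hx.
apply: (@eq_measurable_fun _ _ _ _ _
    (fun z : R * R => mdist (h (cl z.1)) (h (cl z.2)))).
  by move=> z; rewrite inE => -[/cle -> /cle ->].
apply: measurable_funTS; apply: continuous_measurable_fun_prod => z.
apply: (@cvg_mdist R E _ (nbhs z) (fun w => h (cl w.1)) (fun w => h (cl w.2))).
  by apply: (@continuous_comp _ _ _ fst (h \o cl)); [exact: cvg_fst|exact: chc].
by apply: (@continuous_comp _ _ _ snd (h \o cl)); [exact: cvg_snd|exact: chc].
Qed.

Lemma exists_le_mean (R : realType) (f : R -> \bar R) (a b M N : R) :
  a < b -> measurable_fun `[a, b] f -> (forall x, 0 <= f x)%E ->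
  (\int[lebesgue_measure]_(x in `[a, b]) f x <= M%:E)%E -> 0 <= M -> M < N ->
  exists2 y, y \in `[a, b] & (f y <= (N / (b - a))%:E)%E.
Proof.
move=> ab mf f0 fM M0 MN; apply: contrapT => Hn.
have ba : 0 < b - a by rewrite subr_gt0.
have fN y : y \in `[a, b] -> ((N / (b - a))%:E <= f y)%E.
  move=> yab; rewrite leNgt; apply/negP => fy; apply: Hn; exists y => //.
  exact: ltW.
suff : (N%:E <= M%:E)%E by rewrite lee_fin leNgt MN.
apply: le_trans fM.
have <- : (\int[lebesgue_measure]_(x in `[a, b]) (N / (b - a))%:E = N%:E)%E.
  rewrite integral_cst//= lebesgue_measure_itv/= lte_fin ab -EFinD -EFinM.
  by rewrite divfK// gt_eqF.
by apply: ge0_le_integral => // x _; rewrite lee_fin divr_ge0 ?ltW//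
  (le_lt_trans M0).
Qed.

Lemma exists_fiber_bound (R : realType) (k : R * R -> \bar R) (F l x a b : R) :
  measurable_fun setT k -> (forall z, 0 <= k z)%E -> 0 < F -> 0 < l -> a < b ->
  (\int[lebesgue_measure]_u \int[lebesgue_measure]_v k (u, v) <= F%:E)%E ->
  (\int[lebesgue_measure]_v k (x, v) <= (3 * F / l)%:E)%E ->
  exists y, [/\ y \in `[a, b],
    (\int[lebesgue_measure]_v k (y, v) <= (3 * F / (b - a))%:E)%E &
    (k (x, y) <= (9 * F / (l * (b - a)))%:E)%E].
Proof.
move=> mk k0 F0 l0 ab kF kx.
have ba : 0 < b - a by rewrite subr_gt0.
pose A u := (\int[lebesgue_measure]_v k (u, v))%E.
have A0 u : (0 <= A u)%E by exact: integral_ge0.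
have mA : measurable_fun setT A by exact: measurable_fun_fubini_tonelli_F.
have mkx : measurable_fun setT (fun v => k (x, v)).
  by apply: measurableT_comp mk _; exact: measurable_pair1.
have c0 : (0 <= (F^-1)%:E)%E by rewrite lee_fin invr_ge0 ltW.
have d0 : (0 <= (l / (3 * F))%:E)%E by rewrite lee_fin divr_ge0 ?mulr_ge0 ?ltW.
have [|||//||y yab] := @exists_le_mean R
    (fun u => (F^-1)%:E * A u + (l / (3 * F))%:E * k (x, u))%E a b 2 3 ab.
- apply: measurable_funTS; apply: emeasurable_funD; exact: measurable_funeM.
- by move=> u; rewrite adde_ge0 ?mule_ge0.
- rewrite ge0_integralD//=; last 4 first.
  + by move=> u _; rewrite mule_ge0.
  + by apply: measurable_funTS; exact: measurable_funeM.
  + by move=> u _; rewrite mule_ge0.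
  + by apply: measurable_funTS; exact: measurable_funeM.
  rewrite !ge0_integralZl//; [|exact: measurable_funTS..].
  rewrite (_ : 2 = F^-1 * F + l / (3 * F) * (3 * F / l)); last first.
    by field; rewrite !gt_eqF.
  rewrite EFinD !EFinM; apply: leeD; apply: lee_pmul => //.
  + exact: integral_ge0.
  + by apply: le_trans kF; exact: ge0_subset_integral.
  + exact: integral_ge0.
  + by rewrite -!EFinM; apply: le_trans kx; exact: ge0_subset_integral.
- by rewrite ltr_nat.
move=> H; exists y; split => //.
- have : ((F^-1)%:E * A y <= (3 / (b - a))%:E)%E.
    by apply: le_trans H; rewrite leeDl// mule_ge0.
  move/(lee_wpmul2l (x := F%:E)); rewrite lee_fin => /(_ (ltW F0)).
  by rewrite muleA -!EFinM mulfV ?gt_eqF// mul1e mulrCA mulrA.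
- have : ((l / (3 * F))%:E * k (x, y) <= (3 / (b - a))%:E)%E.
    by apply: le_trans H; rewrite leeDr// mule_ge0.
  have e0 : (0 <= (3 * F / l)%:E)%E by rewrite lee_fin divr_ge0 ?mulr_ge0 ?ltW.
  move/(lee_wpmul2l e0).
  rewrite muleA -!EFinM (_ : 3 * F / l * (l / (3 * F)) = 1) ?mul1e; last first.
    by field; rewrite !gt_eqF.
  rewrite (_ : 3 * F / l * (3 / (b - a)) = 9 * F / (l * (b - a)))//.
  by field; rewrite !gt_eqF.
Qed.

Definition sobolev_kernel (R : realType) (E : metricType R) (delta p : R)
    (h : R -> E) (z : R * R) : R :=
  mdist (h z.1) (h z.2) `^ p / `|z.2 - z.1| `^ (1 + delta * p).

Definition sobolev_energy (R : realType) (E : metricType R) (delta p : R)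
    (h : R -> E) (s t : R) : \bar R :=
  (\int[(lebesgue_measure \x lebesgue_measure)%E]_(z in `[s, t] `*` `[s, t])
     (sobolev_kernel delta p h z)%:E)%E.

Lemma sobolev_kernel_ge0 (R : realType) (E : metricType R) (delta p : R)
    (h : R -> E) (z : R * R) : 0 <= sobolev_kernel delta p h z.
Proof. by rewrite divr_ge0// powR_ge0. Qed.

Lemma sobolev_kernel_diag (R : realType) (E : metricType R) (delta p : R)
    (h : R -> E) (x : R) : p != 0 -> sobolev_kernel delta p h (x, x) = 0.
Proof. by move=> p0; rewrite /sobolev_kernel/= mdistxx powR0// mul0r. Qed.

Lemma measurable_sobolev_kernel (R : realType) (E : metricType R)
    (delta p : R) (h : R -> E) (a b : R) :
  a <= b -> {within `[a, b], continuous h} ->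
  measurable_fun (`[a, b] `*` `[a, b]) (sobolev_kernel delta p h).
Proof.
move=> ab ch; apply: (@eq_measurable_fun _ _ _ _ _ (fun z : R * R =>
    mdist (h z.1) (h z.2) `^ p * `|z.2 - z.1| `^ (- (1 + delta * p)))).
  by move=> z _; rewrite powRN.
apply: measurable_funM.
  by apply: (measurableT_comp (measurable_powR p)); exact: measurable_mdist.
apply: measurable_funTS; apply: (measurableT_comp (measurable_powR _)).
by apply: measurableT_comp => //; apply: measurable_funB;
  [exact: measurable_snd|exact: measurable_fst].
Qed.

Lemma mdist_le_sobolev_kernel (R : realType) (E : metricType R) (delta p : R)
    (h : R -> E) (c l x y : R) :
  0 < delta -> 0 < p -> 0 <= c -> 0 < l -> `|y - x| <= l ->
  sobolev_kernel delta p h (x, y) <= c / l ^+ 2 ->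
  mdist (h x) (h y) <= c `^ p^-1 * l `^ (delta - p^-1).
Proof.
move=> d0 p0 c0 l0 xyl Kc.
have e0 : 0 < 1 + delta * p by rewrite addr_gt0 ?mulr_gt0.
suff : mdist (h x) (h y) `^ p <= c * l `^ (delta * p - 1).
  move/(@ge0_ler_powR _ p^-1); rewrite -powRrM mulfV ?gt_eqF// powRr1 ?mdist_ge0//.
  rewrite powRM// ?powR_ge0// -powRrM mulrBl mul1r mulfK ?gt_eqF//; apply.
  - by rewrite invr_ge0 ltW.
  - by rewrite nnegrE powR_ge0.
  - by rewrite nnegrE mulr_ge0 ?powR_ge0.
have [->|xy] := eqVneq x y.
  by rewrite mdistxx powR0 ?gt_eqF// mulr_ge0 ?powR_ge0.
have n0 : 0 < `|y - x| `^ (1 + delta * p).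
  by rewrite powR_gt0// normr_gt0 subr_eq0 eq_sym.
move: Kc; rewrite /sobolev_kernel/= ler_pdivrMr// => /le_trans; apply.
rewrite (_ : c * l `^ (delta * p - 1) = c / l ^+ 2 * l `^ (1 + delta * p)); last first.
  rewrite -mulrA; congr (_ * _); rewrite -(powR_mulrn 2) ?ltW// -powRN -powRD.
    by congr (_ `^ _); ring.
  by rewrite (gt_eqF l0) implybT.
apply: ler_wpM2l; first by rewrite divr_ge0 ?exprn_ge0 ?(ltW l0).
by rewrite ge0_ler_powR ?nnegrE ?(ltW e0) ?(ltW l0).
Qed.

Lemma fubini_sobolev_energy (R : realType) (E : metricType R) (delta p : R)
    (h : R -> E) (s t : R) :
  s <= t -> {within `[s, t], continuous h} ->
  sobolev_energy delta p h s t =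
  (\int[lebesgue_measure]_u \int[lebesgue_measure]_v
    ((sobolev_kernel delta p h \_ (`[s, t] `*` `[s, t])) (u, v))%:E)%E.
Proof.
move=> st ch; have mS : measurable (`[s, t]%classic `*` `[s, t]%classic : set (R * R)).
  exact: measurableX.
have mK := measurable_sobolev_kernel delta p st ch.
transitivity (\int[(lebesgue_measure \x lebesgue_measure)%E]_z
    ((sobolev_kernel delta p h \_ (`[s, t] `*` `[s, t])) z)%:E)%E.
  rewrite /sobolev_energy integral_mkcond; apply: eq_integral => z _.
  by rewrite !patchE; case: ifPn.
have mk : measurable_fun [set: R * R]
    (EFin \o (sobolev_kernel delta p h \_ (`[s, t] `*` `[s, t]))).
  by apply/measurable_EFinP/(measurable_restrictT _ mS).
rewrite fubini_tonelli1//.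
move=> z; rewrite lee_fin patchE; case: ifPn => // _.
exact: sobolev_kernel_ge0.
Qed.

Lemma mdist_chain_bound (R : realType) (E : metricType R) (delta p : R)
    (h : R -> E) (s t F c x0 : R) (a : nat -> R) :
  let S := `[s, t]%classic `*` `[s, t]%classic in
  let k := sobolev_kernel delta p h \_ S in
  let l n := (t - s) * 2^-1 ^+ n in
  0 < delta -> 1 <= p -> 0 < delta - p^-1 ->
  s < t -> {within `[s, t], continuous h} ->
  0 < F -> (sobolev_energy delta p h s t <= F%:E)%E ->
  (forall n, c \in `[a n, a n + l n]) ->
  (forall n, s <= a n /\ a n + l n <= t) ->
  (forall n, a n <= a n.+1 /\ a n.+1 + l n.+1 <= a n + l n) ->
  x0 \in `[a 0%N, a 0%N + l 0%N] ->
  (\int[lebesgue_measure]_v (k (x0, v))%:E <= (3 * F / (t - s))%:E)%E ->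
  mdist (h x0) (h c) <=
    (18 * F) `^ p^-1 * (t - s) `^ (delta - p^-1)
      / (1 - 2^-1 `^ (delta - p^-1)).
Proof.
move=> S k l d0 p1 a0 st ch F0 HF cJ Jst nest x0J Ax0.
set alpha := delta - p^-1 in a0 *.
have p0 : 0 < p by rewrite (lt_le_trans _ p1).
have L0 : 0 < t - s by rewrite subr_gt0.
have l0 n : 0 < l n by rewrite /l mulr_gt0// exprn_gt0// invr_gt0.
have lS n : l n.+1 = l n / 2 by rewrite /l exprSr mulrA.
pose r := (2^-1 : R) `^ alpha.
have r0 : 0 < r by rewrite powR_gt0// invr_gt0.
have r1 : r < 1.
  suff : r < 1 `^ alpha by rewrite powR1.
  by rewrite gt0_ltr_powR ?nnegrE//; lra.
set D := (18 * F) `^ p^-1 * (t - s) `^ alpha.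
have D0 : 0 <= D by rewrite mulr_ge0 ?powR_ge0.
have lalpha n : (18 * F) `^ p^-1 * l n `^ alpha = D * r ^+ n.
  rewrite /l (powRM _ (ltW L0)) ?exprn_ge0 ?invr_ge0// mulrA; congr (_ * _).
  by rewrite -!powR_mulrn ?invr_ge0 ?(ltW r0)// powRAC.
have mS : measurable S by exact: measurableX.
have mk : measurable_fun setT (EFin \o k).
  apply/measurable_EFinP/(measurable_restrictT _ mS).
  exact: measurable_sobolev_kernel (ltW st) ch.
have k0 z : (0 <= (EFin \o k) z)%E.
  by rewrite lee_fin /k patchE; case: ifPn => // _; exact: sobolev_kernel_ge0.
rewrite (fubini_sobolev_energy _ _ (ltW st) ch) in HF.
pose A x := (\int[lebesgue_measure]_v (k (x, v))%:E)%E.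
have chain n : exists x, [/\ x \in `[a n, a n + l n],
    (A x <= (3 * F / l n)%:E)%E &
    mdist (h x0) (h x) <= D * (1 - r ^+ n) / (1 - r)].
  elim: n => [|n [x [xJ Ax xd]]].
    exists x0; split => //; first by rewrite /l expr0 mulr1.
    by rewrite mdistxx expr0 subrr mulr0 mul0r.
  have [|y [yJ Ay kxy]] := @exists_fiber_bound R (EFin \o k) F (l n) x
      (a n.+1) (a n.+1 + l n.+1) mk k0 F0 (l0 n) _ HF Ax.
    by rewrite ltrDl.
  rewrite [_ + _ - _]addrAC subrr add0r in Ay kxy.
  exists y; split => //.
  have [n1 n2] := nest n; have [s1 s2] := Jst n.
  move: xJ yJ; rewrite !in_itv/= => /andP[x1 x2] /andP[y1 y2].
  have xyS : (x, y) \in S by rewrite inE; split; rewrite /= in_itv/=; apply/andP; split; lra.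
  rewrite /= lee_fin /k patchE xyS lS in kxy.
  have : mdist (h x) (h y) <= D * r ^+ n.
    rewrite -lalpha; apply: mdist_le_sobolev_kernel => //.
    - by rewrite mulr_ge0// ltW.
    - by rewrite ler_norml; apply/andP; split; lra.
    - rewrite (_ : 18 * F / l n ^+ 2 = 9 * F / (l n * (l n / 2)))//.
      by field; rewrite gt_eqF.
  move=> xyd; apply: (le_trans (metric_triangle _ (h x) _)).
  apply: (le_trans (lerD xd xyd)); rewrite le_eqVlt; apply/orP; left; apply/eqP.
  by rewrite exprS; field; rewrite subr_eq0 gt_eqF.
have D1 n : D * (1 - r ^+ n) / (1 - r) <= D / (1 - r).
  rewrite ler_pM2r ?invr_gt0 ?subr_gt0// ler_piMr//.
  by rewrite lerBlDr lerDl exprn_ge0// ltW.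
have hc : h @ within `[s, t] (nbhs c) --> h c.
  move/subspace_continuousP : ch; apply => /=.
  have [s1 s2] := Jst 0%N; move: (cJ 0%N); rewrite !in_itv/= => /andP[c1 c2].
  by apply/andP; split; lra.
apply/ler_addgt0Pr => e e0.
have : within `[s, t]%classic (nbhs c) (fun x => ball (h c) e (h x)).
  exact: hc _ (nbhsx_ballx (h c) e e0).
move=> /nbhs_ballP[eta /= eta0 He].
have [n ln] : exists n, l n < eta.
  have : l n @[n --> \oo] --> (t - s) * 0.
    apply: cvgMr; apply: cvg_expr; rewrite ger0_norm ?invr_ge0//; lra.
  rewrite mulr0 => /cvgrPdist_lt/(_ _ eta0)[n _ /(_ n (leqnn n))].
  by rewrite sub0r normrN gtr0_norm//; exists n.
have [x [xJ _ xd]] := chain n.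
have [s1 s2] := Jst n.
move: xJ (cJ n); rewrite !in_itv/= => /andP[x1 x2] /andP[c1 c2].
have := He x; rewrite ballEmdist /ball/= => /(_ _ _) Hx.
have {}Hx : mdist (h c) (h x) < e.
  apply: Hx; last by rewrite in_itv/=; apply/andP; split; lra.
  by rewrite ltr_norml; apply/andP; split; lra.
apply: (le_trans (metric_triangle _ (h x) _)).
rewrite (metric_sym (h x)); apply: lerD; last exact: ltW.
exact: le_trans xd (D1 n).
Qed.

Definition holder_constant (R : realType) (delta p : R) : R :=
  2 * 18 `^ p^-1 / (1 - 2^-1 `^ (delta - p^-1)).

Lemma holder_constant_gt0 (R : realType) (delta p : R) :
  0 < delta - p^-1 -> 0 < holder_constant delta p.
Proof.
move=> a0; rewrite divr_gt0 ?mulr_gt0 ?powR_gt0// subr_gt0.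
suff : (2^-1 : R) `^ (delta - p^-1) < 1 `^ (delta - p^-1) by rewrite powR1.
by rewrite gt0_ltr_powR ?nnegrE//; lra.
Qed.

Lemma sobolev_energy_ge0 (R : realType) (E : metricType R) (delta p : R)
  (h : R -> E) (s t : R) : (0 <= sobolev_energy delta p h s t)%E.
Proof. by apply: integral_ge0 => z _; rewrite lee_fin sobolev_kernel_ge0. Qed.

Lemma mdist_le_of_sobolev_energy_le (R : realType) (E : metricType R)
    (delta p : R) (h : R -> E) (s t F : R) :
  0 < delta -> 1 <= p -> 0 < delta - p^-1 ->
  s < t -> {within `[s, t], continuous h} ->
  0 < F -> (sobolev_energy delta p h s t < F%:E)%E ->
  mdist (h s) (h t) <=
    holder_constant delta p * (F `^ p^-1 * (t - s) `^ (delta - p^-1)).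
Proof.
move=> d0 p1 a0 st ch F0 HF.
have L0 : 0 < t - s by rewrite subr_gt0.
pose l n : R := (t - s) * 2^-1 ^+ n.
have lS n : l n.+1 = l n / 2 by rewrite /l exprSr mulrA.
have l00 : l 0%N = t - s by rewrite /l expr0 mulr1.
have l0 n : 0 < l n by rewrite /l mulr_gt0// exprn_gt0// invr_gt0.
have lL n : l n <= t - s.
  elim: n => [|n ih]; first by rewrite l00.
  by rewrite lS; have := l0 n; lra.
have mS : measurable (`[s, t]%classic `*` `[s, t]%classic : set (R * R)).
  exact: measurableX.
pose k := sobolev_kernel delta p h \_ (`[s, t]%classic `*` `[s, t]%classic).
have mk : measurable_fun setT (EFin \o k).
  apply/measurable_EFinP/(measurable_restrictT _ mS).
  exact: measurable_sobolev_kernel (ltW st) ch.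
have k0 z : (0 <= (EFin \o k) z)%E.
  by rewrite lee_fin /k patchE; case: ifPn => // _; exact: sobolev_kernel_ge0.
pose A u := (\int[lebesgue_measure]_v (EFin \o k) (u, v))%E.
have A0 u : (0 <= A u)%E by exact: integral_ge0.
have mA : measurable_fun setT A by exact: measurable_fun_fubini_tonelli_F.
have [] : exists2 x0, x0 \in `[s, t] &
    (\int[lebesgue_measure]_v (k (x0, v))%:E <= (3 * F / (t - s))%:E)%E.
  apply: (@exists_le_mean R A s t F) => //.
  - exact: measurable_funTS.
  - rewrite (fubini_sobolev_energy _ _ (ltW st) ch) in HF.
    by apply: le_trans (ltW HF); apply: ge0_subset_integral.
  - exact: ltW.
  - by rewrite ltr_pMl// ltr1n.
move=> x0 x0J Ax0.
have st1 : s <= t by exact: ltW.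
have left_bound : mdist (h x0) (h s) <= (18 * F) `^ p^-1 *
    (t - s) `^ (delta - p^-1) / (1 - 2^-1 `^ (delta - p^-1)).
  apply: (@mdist_chain_bound R E delta p h s t F s x0 (fun=> s)) => //.
  - exact: ltW.
  - by move=> n; rewrite in_itv/= lexx/= lerDl; exact: ltW (l0 n).
  - by move=> n; split => //; have := lL n; rewrite /l; lra.
  - by move=> n; split => //; move: (lS n) (l0 n); rewrite /l => ? ?; lra.
  - by rewrite -/(l 0%N) l00 addrC subrK.
have right_bound : mdist (h x0) (h t) <= (18 * F) `^ p^-1 *
    (t - s) `^ (delta - p^-1) / (1 - 2^-1 `^ (delta - p^-1)).
  apply: (@mdist_chain_bound R E delta p h s t F t x0 (fun n => t - l n)) => //.
  - exact: ltW.
  - by move=> n; rewrite subrK in_itv/= lexx andbT gerBl; exact: ltW (l0 n).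
  - by move=> n; rewrite subrK; split => //; have := lL n; lra.
  - move=> n; rewrite !subrK; split => //.
    by have := lS n; have := l0 n => ? ?; lra.
  - by rewrite subrK l00 opprB addrC subrK.
apply: (le_trans (metric_triangle _ (h x0) _)).
rewrite (metric_sym (h s)); apply: (le_trans (lerD left_bound right_bound)).
rewrite (powRM _ _ (ltW F0))// /holder_constant le_eqVlt; apply/orP; left.
apply/eqP; set u := 1 - _; set c := 18 `^ _; set f := F `^ _.
by ring.
Qed.

Lemma mdist_le_sobolev_energy (R : realType) (E : metricType R)
    (delta p : R) (h : R -> E) (s t : R) :
  0 < delta -> 1 <= p -> 0 < delta - p^-1 ->
  s <= t -> {within `[s, t], continuous h} ->
  (sobolev_energy delta p h s t < +oo)%E ->
  mdist (h s) (h t) <= holder_constant delta p *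
    (fine (sobolev_energy delta p h s t) `^ p^-1 * (t - s) `^ (delta - p^-1)).
Proof.
move=> d0 p1 a0 + ch Foo; rewrite le_eqVlt => /predU1P[<-|st].
  rewrite mdistxx; apply: mulr_ge0; first exact/ltW/holder_constant_gt0.
  by rewrite mulr_ge0 ?powR_ge0.
have p0 : 0 < p by rewrite (lt_le_trans _ p1).
set F := sobolev_energy delta p h s t in Foo *.
have F0 : 0 <= fine F by rewrite fine_ge0// sobolev_energy_ge0.
have FE : F = (fine F)%:E by rewrite fineK// ge0_fin_numE// sobolev_energy_ge0.
set B := holder_constant delta p; set alpha := delta - p^-1.
have B0 : 0 < B by exact: holder_constant_gt0.
have BL0 : 0 <= B * (t - s) `^ alpha.
  by apply: mulr_ge0 (powR_ge0 _ _); exact: ltW.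
pose W := (B * (t - s) `^ alpha) `^ p.
have W0 : 0 < W by rewrite powR_gt0// mulr_gt0// powR_gt0// subr_gt0.
have step e : 0 < e -> mdist (h s) (h t) `^ p <= W * (fine F + e).
  move=> e0; have Fe0 : 0 < fine F + e by rewrite ltr_wpDl.
  have : mdist (h s) (h t) <= B * ((fine F + e) `^ p^-1 * (t - s) `^ alpha).
    apply: mdist_le_of_sobolev_energy_le => //.
    by rewrite -/F FE lte_fin ltrDl.
  rewrite [X in B * X]mulrC mulrA => H.
  have := @ge0_ler_powR _ p (ltW p0) _ _ _ _ H.
  rewrite powRM ?powR_ge0//.
  rewrite -powRrM mulVf ?gt_eqF// powRr1 ?(ltW Fe0)//.
  apply; rewrite nnegrE ?mdist_ge0//.
  exact: mulr_ge0 BL0 (powR_ge0 _ _).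
have : mdist (h s) (h t) `^ p <= W * fine F.
  rewrite -ler_pdivrMl//; apply/ler_addgt0Pr => e e0.
  by rewrite ler_pdivrMl//; exact: step.
move=> H; rewrite [X in B * X]mulrC mulrA; have := @ge0_ler_powR _ p^-1 _ _ _ _ _ H.
rewrite powRM ?powR_ge0// -!powRrM mulfV ?gt_eqF// !powRr1 ?mdist_ge0//.
apply.
- by rewrite invr_ge0 ltW.
- by rewrite nnegrE powR_ge0.
- by rewrite nnegrE mulr_ge0// ltW.
Qed.

Lemma sobolev_energy_subset (R : realType) (E : metricType R) (delta p : R)
    (h : R -> E) (a b s t : R) :
  a <= s -> s <= t -> t <= b -> {within `[a, b], continuous h} ->
  (sobolev_energy delta p h s t <= sobolev_energy delta p h a b)%E.
Proof.
move=> as_ st tb ch; have ab : a <= b by rewrite (le_trans as_)// (le_trans st).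
have sub : `[s, t] `<=` `[a, b].
  by apply: subset_itv; rewrite bnd_simp.
have mS (x y : R) : measurable (`[x, y]%classic `*` `[x, y]%classic : set (R * R)).
  exact: measurableX.
apply: ge0_subset_integral; [exact: mS|exact: mS| | |].
- by apply/measurable_EFinP; exact: measurable_sobolev_kernel.
- by move=> z _; rewrite lee_fin sobolev_kernel_ge0.
- by move=> z [z1 z2]; split; exact: sub.
Qed.

(* The squares [s, t]^2 and [t, u]^2 share the corner (t, t), where the kernel
   vanishes. *)
Lemma sobolev_energy_superadditive (R : realType) (E : metricType R)
    (delta p : R) (h : R -> E) (s t u : R) :
  p != 0 -> s <= t -> t <= u -> {within `[s, u], continuous h} ->
  (sobolev_energy delta p h s t + sobolev_energy delta p h t u
    <= sobolev_energy delta p h s u)%E.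
Proof.
move=> p0 st tu ch.
have mS (x y : R) : measurable (`[x, y]%classic `*` `[x, y]%classic : set (R * R)).
  exact: measurableX.
have mK : measurable_fun (`[s, u] `*` `[s, u]) (sobolev_kernel delta p h).
  exact: measurable_sobolev_kernel (le_trans st tu) ch.
pose k x y z := (sobolev_kernel delta p h \_
  (`[x, y]%classic `*` `[x, y]%classic) : R * R -> R) z.
have kE x y : sobolev_energy delta p h x y =
    (\int[(lebesgue_measure \x lebesgue_measure)%E]_z (k x y z)%:E)%E.
  rewrite /sobolev_energy integral_mkcond; apply: eq_integral => z _.
  by rewrite /k !patchE; case: ifPn.
have k0 x y z : (0 <= (k x y z)%:E)%E.
  by rewrite lee_fin /k patchE; case: ifPn => // _; exact: sobolev_kernel_ge0.
have mk x y : s <= x -> y <= u -> measurable_fun [set: R * R] (EFin \o k x y).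
  move=> sx yu; apply/measurable_EFinP/(measurable_restrictT _ (mS x y)).
  apply: measurable_funS mK; first exact: mS.
  by move=> z [z1 z2]; split; [move: z1|move: z2]; apply: subset_itv;
    rewrite bnd_simp.
have mst := mk s t (lexx s) tu; have mtu := mk t u st (lexx u).
have msu := mk s u (lexx s) (lexx u).
rewrite !kE -ge0_integralD//; apply: ge0_le_integral => //.
- by move=> z _; rewrite adde_ge0.
- exact: emeasurable_funD mst mtu.
move=> -[x y] _; rewrite -EFinD lee_fin /k !patchE.
have K0 := sobolev_kernel_ge0 delta p h (x, y).
have inE' (a b : R) : ((x, y) \in `[a, b]%classic `*` `[a, b]%classic) =
    [&& a <= x, x <= b, a <= y & y <= b].
  apply/idP/idP; first by rewrite inE => -[/=]; rewrite !in_itv/= => /andP[-> ->].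
  by move=> /and4P[? ? ? ?]; rewrite inE; split; rewrite /= in_itv/=; apply/andP.
rewrite !inE'; case: ifPn => [/and4P[sx xt sy yt]|nst].
  rewrite sx sy (le_trans xt tu) (le_trans yt tu)/= !andbT.
  case: ifPn => [/andP[tx ty]|_]; last by rewrite addr0.
  have -> : x = t by apply/eqP; rewrite eq_le xt.
  have -> : y = t by apply/eqP; rewrite eq_le yt.
  by rewrite sobolev_kernel_diag// addr0.
rewrite add0r; case: ifPn => [/and4P[tx xu ty yu]|_].
  by rewrite (le_trans st tx) xu (le_trans st ty) yu.
by case: ifPn.
Qed.

Lemma hoelder2_superadditive (R : realType) (a b x1 x2 y1 y2 : R) :
  0 < a -> 0 < b -> a + b = 1 -> 0 <= x1 -> 0 <= x2 -> 0 <= y1 -> 0 <= y2 ->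
  x1 `^ a * y1 `^ b + x2 `^ a * y2 `^ b <= (x1 + x2) `^ a * (y1 + y2) `^ b.
Proof.
move=> a0 b0 ab x10 x20 y10 y20.
have := @hoelder2 R (x1 `^ a) (x2 `^ a) (y1 `^ b) (y2 `^ b) a^-1 b^-1.
rewrite -!powRrM !mulfV ?gt_eqF// !powRr1// !invrK.
by apply; rewrite ?powR_ge0 ?invr_gt0.
Qed.

Lemma continuous_powR_norm (R : realType) (a : R) :
  0 < a -> continuous (fun x : R => `|x| `^ a).
Proof.
move=> a0 x; have [->|x0] := eqVneq x 0.
  apply/cvgrPdist_lt => e e0; rewrite normr0 powR0 ?gt_eqF//.
  near=> y; rewrite sub0r normrN ger0_norm ?powR_ge0//.
  have -> : e = (e `^ a^-1) `^ a.
    by rewrite -powRrM mulVf ?gt_eqF// powRr1// ltW.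
  rewrite gt0_ltr_powR ?nnegrE ?powR_ge0//.
  near: y; apply: (@nbhs0_lt R R); exact: powR_gt0.
apply: (@continuous_comp _ _ _ (@Num.norm R R) (@powR R ^~ a)).
  exact: norm_continuous.
apply/differentiable_continuous/derivable1_diffP/derivable_powR.
by rewrite in_itv/= andbT normr_gt0.
Unshelve. all: end_near. Qed.

Lemma ge0_integral_setU_le d (T : measurableType d) (R : realType)
    (mu : {measure set T -> \bar R}) (A B : set T) (f : T -> \bar R) :
  measurable A -> measurable B -> measurable_fun (A `|` B) f ->
  (forall x, 0 <= f x)%E ->
  (\int[mu]_(x in A `|` B) f x
    <= \int[mu]_(x in A) f x + \int[mu]_(x in B) f x)%E.
Proof.
move=> mA mB mf f0; have AB : A `|` B = A `|` (B `\` A).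
  by rewrite setDE setUIr setUv setIT.
rewrite AB in mf *; rewrite ge0_integral_setU//; last 2 first.
- exact: measurableD.
- by apply/disj_setPS => x [Ax [_ /(_ Ax)]].
apply: leeD => //; apply: ge0_subset_integral => //; first exact: measurableD.
by apply: measurable_funS mf; [rewrite -AB; exact: measurableU|rewrite -AB].
Qed.

Local Notation lebesgue2 := (lebesgue_measure \x lebesgue_measure)%E.

(* When (s', t') is within eta of (s, t), the two squares differ by a subset of
   the strips W below, of measure O(eta), and the integral is absolutely
   continuous. *)
Lemma continuous_sobolev_energy (R : realType) (E : metricType R) (delta p : R)
    (h : R -> E) : {within `[0, 1], continuous h} ->
  (sobolev_energy delta p h 0 1 < +oo)%E ->
  {within @simplex01 R,
    continuous (fun z : R * R => fine (sobolev_energy delta p h z.1 z.2))}.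
Proof.
move=> ch Foo.
pose sq (s t : R) : set (R * R) := `[s, t]%classic `*` `[s, t]%classic.
have msq s t : measurable (sq s t) by exact: measurableX.
have mK : measurable_fun (sq 0 1) (sobolev_kernel delta p h).
  exact: measurable_sobolev_kernel ler01 ch.
pose k : R * R -> R := sobolev_kernel delta p h \_ (sq 0 1).
have mk : measurable_fun [set: R * R] (EFin \o k).
  exact/measurable_EFinP/(measurable_restrictT _ (msq 0 1)).
have k0 z : 0 <= k z.
  by rewrite /k patchE; case: ifPn => // _; exact: sobolev_kernel_ge0.
have k0E z : (0 <= (EFin \o k) z)%E by rewrite lee_fin.
have kE s t : 0 <= s -> t <= 1 -> sobolev_energy delta p h s t =
    (\int[lebesgue2]_(z in sq s t) (k z)%:E)%E.
  move=> s0 t1; apply: eq_integral => z; rewrite inE => -[z1 z2].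
  rewrite /k patchE ifT// inE; split; [move: z1|move: z2]; apply: subset_itv;
    by rewrite bnd_simp.
have ki : lebesgue2.-integrable setT (EFin \o k).
  apply/integrableP; split => //.
  under eq_integral do rewrite gee0_abs//.
  rewrite /sobolev_energy integral_mkcond in Foo.
  apply: le_lt_trans Foo; rewrite le_eqVlt; apply/orP; left; apply/eqP.
  by apply: eq_integral => z _; rewrite /k /= !patchE; case: ifPn.
have Ffin s t : 0 <= s -> s <= t -> t <= 1 ->
    sobolev_energy delta p h s t \is a fin_num.
  move=> s0 st t1; rewrite ge0_fin_numE ?sobolev_energy_ge0//.
  exact: le_lt_trans (sobolev_energy_subset _ _ s0 st t1 ch) Foo.
apply/subspace_continuousP => -[s t] [/= s0 [st t1]].
apply/cvgrPdist_lt => e e0.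
have [d [d0 Hd]] := integral_normr_continuous ki e0.
pose eta : R := d / 16.
have eta0 : 0 < eta by rewrite divr_gt0.
pose V : set R := ball s eta `|` ball t eta.
have mV : measurable V by apply: measurableU; exact: measurable_ball.
have muV : (lebesgue_measure V <= (eta *+ 4)%:E)%E.
  apply: (@le_trans _ _ (lebesgue_measure (ball s eta) + lebesgue_measure (ball t eta))%E).
    by apply: measureU2; exact: measurable_ball.
  rewrite !lebesgue_measure_ball ?(ltW eta0)// -EFinD lee_fin.
  by rewrite -mulrnDr lexx.
pose I : set R := `[0, 1]%classic.
have mI : measurable I by exact: measurable_itv.
pose W : set (R * R) := (V `*` I) `|` (I `*` V).
have mW : measurable W by apply: measurableU; apply: measurableX.
have muW : (lebesgue2 W < d%:E)%E.
  apply: (@le_lt_trans _ _ (lebesgue2 (V `*` I) + lebesgue2 (I `*` V))%E).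
    by apply: measureU2; apply: measurableX.
  rewrite !product_measure1E//=.
  have -> : lebesgue_measure I = 1%E.
    by rewrite /I lebesgue_measure_itv/= lte_fin ltr01 oppr0 adde0.
  rewrite mule1 mul1e; apply: (le_lt_trans (leeD muV muV)).
  by rewrite -EFinD lte_fin /eta; lra.
have kW : (\int[lebesgue2]_(z in W) (k z)%:E < e%:E)%E.
  have kWfin : (\int[lebesgue2]_(z in W) (k z)%:E)%E \is a fin_num.
    rewrite ge0_fin_numE; last by apply: integral_ge0 => z _; exact: k0E.
    have /integrableP[_] := ki; apply: le_lt_trans.
    under [leRHS]eq_integral do rewrite gee0_abs//.
    by apply: ge0_subset_integral => // z _; exact: k0E.
  rewrite -(fineK kWfin) lte_fin; apply: le_lt_trans (Hd W mW muW).
  by under [leRHS]eq_Rintegral do rewrite ger0_norm//.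
have close s' t' s'' t'' : 0 <= s' -> s' <= t' -> t' <= 1 ->
    0 <= s'' -> s'' <= t'' -> t'' <= 1 ->
    (sq s' t' `<=` sq s'' t'' `|` W) ->
    fine (sobolev_energy delta p h s' t') < fine (sobolev_energy delta p h s'' t'') + e.
  move=> s'0 st' t'1 s''0 st'' t''1 sub.
  rewrite -lte_fin EFinD !fineK ?Ffin// !kE//.
  apply: (@le_lt_trans _ _ (\int[lebesgue2]_(z in sq s'' t'' `|` W) (k z)%:E)%E).
    apply: ge0_subset_integral => //.
    - exact: msq.
    - by apply: measurableU => //; exact: msq.
    - exact: (measurable_funTS mk).
    - by move=> w _; exact: k0E.
  apply: (@le_lt_trans _ _ (\int[lebesgue2]_(z in sq s'' t'') (k z)%:E
      + \int[lebesgue2]_(z in W) (k z)%:E)%E).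
    apply: ge0_integral_setU_le => //.
    - exact: msq.
    - exact: (measurable_funTS mk).
  by rewrite lteD2lE -?kE ?Ffin.
have subW x y x' y' : 0 <= x -> y <= 1 ->
    (forall w, x <= w -> w <= y -> w < x' \/ y' < w -> V w) ->
    sq x y `<=` sq x' y' `|` W.
  move=> x0 y1 HV [u v] [/=]; rewrite !in_itv/= => /andP[xu uy] /andP[xv vy].
  have Iu : I u by rewrite /I/= in_itv/=; apply/andP; split; lra.
  have Iv : I v by rewrite /I/= in_itv/=; apply/andP; split; lra.
  have [ux|x'u] := ltP u x'; first by right;
    left; split => //=; apply: HV => //; left.
  have [uy'|y'u] := ltP y' u; first by right;
    left; split => //=; apply: HV => //; right.
  have [vx|x'v] := ltP v x'; first by right;
    right; split => //=; apply: HV => //; left.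
  have [vy'|y'v] := ltP y' v; first by right;
    right; split => //=; apply: HV => //; right.
  by left; split; rewrite /= in_itv/=; apply/andP.
near=> z.
have [z0 [z12 z1]] : @simplex01 R z by near: z; exact: withinT.
have [bs bt] : ball (s, t) eta z by near: z; apply: cvg_within; exact: nbhsx_ballx.
have : `|(s : R) - z.1| < eta by exact: bs.
have : `|(t : R) - z.2| < eta by exact: bt.
rewrite !ltr_norml => /andP[zt1 zt2] /andP[zs1 zs2].
have VE w : `|(s : R) - w| < eta \/ `|(t : R) - w| < eta -> V w by [].
have := close s t z.1 z.2 s0 st t1 z0 z12 z1.
have := close z.1 z.2 s t z0 z12 z1 s0 st t1.
move=> H1 H2; apply/andP; split.
  rewrite ltrNl opprB ltrBlDl; apply: H1; apply: subW => // w xw wy.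
  by case=> ?; apply: VE; [left|right]; rewrite ltr_norml; apply/andP; split; lra.
rewrite ltrBlDl; apply: H2; apply: subW => // w xw wy.
by case=> ?; apply: VE; [left|right]; rewrite ltr_norml; apply/andP; split; lra.
Unshelve. all: end_near. Qed.

Lemma sum_itv_partition_le (R : realType) (d omega : R -> R -> R) (a b : R) :
  (forall s t, a <= s -> s <= t -> t <= b -> d s t <= omega s t) ->
  (forall s t, a <= s -> s <= t -> t <= b -> 0 <= omega s t) ->
  (forall s t u, a <= s -> s <= t -> t <= u -> u <= b ->
    omega s t + omega t u <= omega s u) ->
  forall l s t, a <= s -> t <= b -> itv_partition s t l ->
  \sum_(i < size l) d (nth t (s :: l) i) (nth t (s :: l) i.+1) <= omega s t.
Proof.
move=> domega omega0 superadd; elim=> [|x l ih] s t as_ tb stl.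
  by rewrite big_ord0 omega0// (itv_partition_le stl).
have xt := itv_partition_le (itv_partition_cons stl).
have sx : s <= x by case: stl => /= /andP[/ltW].
rewrite big_ord_recl/=; apply: le_trans (superadd s x t as_ sx xt tb).
apply: lerD; first by apply: domega => //; exact: le_trans xt tb.
by apply: ih => //; [exact: le_trans as_ sx|exact: itv_partition_cons stl].
Qed.

Lemma q_variation_ge0 (R : realType) (E : metricType R) (q : R) (h : R -> E)
  (s t : R) : s <= t -> (0 <= q_variation q h s t)%E.
Proof.
rewrite le_eqVlt => st; have [l stl] : exists l, itv_partition s t l.
  case/predU1P: st => [->|st]; first by exists [::]; split => /=.
  by exists [:: t]; exact: itv_partition1.
apply: le_trans (ereal_sup_ubound _); last by exists l.
by rewrite lee_fin powR_ge0.
Qed.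

Theorem mainTheorem3 (R : realType) (delta p : R)
    (delta_gt0 : 0 < delta) (delta_lt1 : delta < 1) (p_ge1 : 1 <= p)
    (alpha_gt0 : 0 < delta - p^-1) :
  let alpha := delta - p^-1 in
  let q := delta^-1 in
  exists2 C : R, 0 < C &
    forall (E : metricType R) (h : R -> E),
      {within `[0, 1], continuous h} ->
      (sobolev_norm delta p h 0 1 < +oo)%E ->
      let omega := fun s t : R =>
        (sobolev_norm delta p h s t `^ q * ((t - s) `^ (alpha * q))%:E)%E in
      [/\ is_control omega,
          forall s t : R, 0 <= s -> s <= t -> t <= 1 ->
            (q_variation q h s t `^ q <= C%:E * omega s t)%E,
          (holder_norm alpha h
             <= (C `^ q^-1)%:E * sobolev_norm delta p h 0 1)%E &
          (q_variation q h 0 1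
             <= (C `^ q^-1)%:E * sobolev_norm delta p h 0 1)%E].
Proof.
move=> alpha q.
have p0 : 0 < p by rewrite (lt_le_trans _ p_ge1).
have q0 : 0 < q by rewrite invr_gt0.
have qV : q^-1 = delta by rewrite invrK.
pose B := holder_constant delta p.
have B0 : 0 < B by exact: holder_constant_gt0.
have BV : (B `^ q) `^ q^-1 = B by rewrite -powRrM mulfV ?gt_eqF// powRr1 ?ltW.
exists (B `^ q); first exact: powR_gt0.
move=> E h ch Foo omega.
have chst s t : 0 <= s -> t <= 1 -> {within `[s, t], continuous h}.
  by move=> s0 t1; apply: continuous_subspaceW ch; apply: subset_itv;
    rewrite bnd_simp.
have {}Foo : (sobolev_energy delta p h 0 1 < +oo)%E.
  by apply: lty_poweRy Foo; rewrite invr_eq0 gt_eqF.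
have Fle s t : 0 <= s -> s <= t -> t <= 1 ->
    (sobolev_energy delta p h s t <= sobolev_energy delta p h 0 1)%E.
  by move=> s0 st t1; exact: sobolev_energy_subset.
have Ffin s t : 0 <= s -> s <= t -> t <= 1 ->
    sobolev_energy delta p h s t \is a fin_num.
  move=> s0 st t1; rewrite ge0_fin_numE ?sobolev_energy_ge0//.
  exact: le_lt_trans (Fle _ _ s0 st t1) Foo.
pose F s t := fine (sobolev_energy delta p h s t).
have F0 s t : 0 <= F s t by rewrite fine_ge0// sobolev_energy_ge0.
have normE s t : 0 <= s -> s <= t -> t <= 1 ->
    sobolev_norm delta p h s t = (F s t `^ p^-1)%:E.
  move=> s0 st t1; rewrite -poweR_EFin /F fineK//; exact: Ffin.
pose w s t := F s t `^ (p^-1 * q) * (t - s) `^ (alpha * q).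
have w0 s t : 0 <= w s t by rewrite mulr_ge0 ?powR_ge0.
have omegaE s t : 0 <= s -> s <= t -> t <= 1 -> omega s t = (w s t)%:E.
  by move=> s0 st t1; rewrite /omega normE// poweR_EFin -powRrM -EFinM.
have exps : p^-1 * q + alpha * q = 1.
  by rewrite -mulrDl addrC subrK mulfV// gt_eqF.
have pq0 : 0 < p^-1 * q by rewrite mulr_gt0// invr_gt0.
have aq0 : 0 < alpha * q by rewrite mulr_gt0.
have superadd s t u : 0 <= s -> s <= t -> t <= u -> u <= 1 ->
    w s t + w t u <= w s u.
  move=> s0 st tu u1; have su := le_trans st tu.
  have t0 := le_trans s0 st; have t1 := le_trans tu u1.
  have FD : F s t + F t u <= F s u.
    rewrite -lee_fin EFinD !fineK ?Ffin//.
    by apply: sobolev_energy_superadditive; rewrite ?gt_eqF//; exact: chst.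
  apply: (@le_trans _ _ ((F s t + F t u) `^ (p^-1 * q)
      * ((t - s) + (u - t)) `^ (alpha * q))).
    by apply: hoelder2_superadditive; rewrite ?subr_ge0.
  have -> : t - s + (u - t) = u - s by ring.
  apply: ler_wpM2r; first exact: powR_ge0.
  by apply: ge0_ler_powR; rewrite ?nnegrE ?addr_ge0// ltW.
have mdistF s t : 0 <= s -> s <= t -> t <= 1 ->
    mdist (h s) (h t) <= B * (F s t `^ p^-1 * (t - s) `^ alpha).
  move=> s0 st t1; apply: mdist_le_sobolev_energy => //; first exact: chst.
  by rewrite -ge0_fin_numE ?sobolev_energy_ge0// Ffin.
have mdistw s t : 0 <= s -> s <= t -> t <= 1 ->
    mdist (h s) (h t) `^ q <= B `^ q * w s t.
  move=> s0 st t1; have := mdistF s t s0 st t1.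
  have X0 : 0 <= F s t `^ p^-1 * (t - s) `^ alpha by rewrite mulr_ge0 ?powR_ge0.
  rewrite /w !powRrM -powRM ?powR_ge0// -powRM// ?(ltW B0)//.
  move=> H; apply: ge0_ler_powR => //; first exact: ltW.
  - by rewrite nnegrE mdist_ge0.
  - by rewrite nnegrE mulr_ge0// ltW.
have qvarw s t : 0 <= s -> s <= t -> t <= 1 ->
    (q_variation q h s t <= ((B `^ q * w s t) `^ q^-1)%:E)%E.
  move=> s0 st t1; apply: ge_ereal_sup => _ [l stl <-]; rewrite lee_fin.
  apply: ge0_ler_powR; first by rewrite qV ltW.
  - by rewrite nnegrE sumr_ge0// => i _; rewrite powR_ge0.
  - by rewrite nnegrE mulr_ge0 ?powR_ge0.
  apply: (@sum_itv_partition_le R (fun x y => mdist (h x) (h y) `^ q)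
    (fun x y => B `^ q * w x y) 0 1) => //.
  - by move=> x y _ _ _; rewrite mulr_ge0 ?powR_ge0.
  - move=> x y z x_ xy yz z1; rewrite -mulrDr.
    by apply: ler_wpM2l; [exact: powR_ge0|exact: superadd].
split.
- split.
  + by move=> s t s0 st t1; rewrite omegaE// lee_fin w0 ltry.
  + have /subspace_continuousP cF := continuous_sobolev_energy ch Foo.
    have cw : {within @simplex01 R, continuous (fun z : R * R =>
        (`|F z.1 z.2| `^ (p^-1 * q) * `|z.2 - z.1| `^ (alpha * q))%:E)}.
      apply/subspace_continuousP => z Az; apply: cvg_EFin; first by near=> x.
      apply: cvgM.
        apply: (@cvg_comp _ _ _ (fun z : R * R => F z.1 z.2)
          (fun x : R => `|x| `^ (p^-1 * q)) _ _ _ (cF z Az)).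
        exact: continuous_powR_norm.
      apply: cvg_within_filter.
      apply: (@continuous_comp _ _ _ (fun z : R * R => z.2 - z.1)
          (fun x : R => `|x| `^ (alpha * q))).
        by apply: cvgB; [exact: cvg_snd|exact: cvg_fst].
      exact: continuous_powR_norm.
    apply: subspace_eq_continuous cw => z; rewrite inE => -[z0 [z12 z1]].
    by rewrite /from_subspace omegaE// /w !ger0_norm ?subr_ge0.
  + move=> s t u s0 st tu u1; have su := le_trans st tu.
    have t0 := le_trans s0 st; have t1 := le_trans tu u1.
    by rewrite !omegaE// -EFinD lee_fin superadd.
- move=> s t s0 st t1; rewrite omegaE//.
  apply: (@le_trans _ _ (((B `^ q * w s t) `^ q^-1)%:E `^ q)%E).
    apply: gt0_ler_poweR; [exact: ltW| | |exact: qvarw].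
    + by rewrite in_itv/= q_variation_ge0// leey.
    + by rewrite in_itv/= lee_fin powR_ge0 leey.
  rewrite poweR_EFin -powRrM mulVf ?gt_eqF// powRr1 ?mulr_ge0 ?powR_ge0//.
- rewrite BV normE ?ler01// -EFinM; apply: ge_ereal_sup => _ [[s t] /= [s0 [st t1]] <-].
  have st0 : 0 < t - s by rewrite subr_gt0.
  rewrite lee_fin gtr0_norm// ler_pdivrMr ?powR_gt0// -mulrA.
  apply: (le_trans (mdistF s t s0 (ltW st) t1)).
  apply: ler_wpM2l; first exact: ltW.
  apply: ler_wpM2r; first exact: powR_ge0.
  apply: ge0_ler_powR; rewrite ?nnegrE ?invr_ge0 ?(ltW p0)//.
  by apply: fine_le; rewrite ?Ffin ?(ltW st)//; exact: Fle (ltW st) t1.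
- rewrite BV normE ?ler01// -EFinM.
  apply: (le_trans (qvarw 0 1 (lexx 0) ler01 (lexx 1))).
  rewrite lee_fin /w subr0 powR1 mulr1 powRM ?powR_ge0// BV.
  by rewrite powRrM -[X in _ * X]powRrM mulfV ?gt_eqF// powRr1 ?powR_ge0.
Unshelve. all: end_near. Qed.
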